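(* Let $Y=(X,\{R_i\}_{0\le i\le D})$ be a symmetric $D$-class association scheme which is $Q$-polynomial with respect to an ordering $E_0,E_1,\dots,E_D$ of its primitive idempotents, and let $m_i=\operatorname{rank}(E_i)$ $(0\le i\le D)$ be the corresponding multiplicities. If $Y$ is dual-thin, then for every integer $i$ with $0\le i<D/2$, $$m_i\le m_{i+1}\quad\text{and}\quad m_i\le m_{D-i}.$$
   Context: Symmetric association scheme. A symmetric $D$-class association scheme ($D\ge 1$) is a pair $Y=(X,\{R_i\}_{0\le i\le D})$ where $X$ is a finite nonempty set and $R_0,\dots,R_D$ are nonempty symmetric relations partitioning $X\times X$, with $R_0=\{(x,x):x\in X\}$, such that for all $h,i,j$ there is a number $p^h_{ij}$ with $|\{z\in X:(x,z)\in R_i,\ (z,y)\in R_j\}|=p^h_{ij}$ for every $(x,y)\in R_h$. Let $\mathrm{Mat}_X(\mathbb{C})$ be the algebra of complex matrices with rows and columns indexed by $X$. The associate matrices $A_0,\dots,A_D\in\mathrm{Mat}_X(\mathbb{C})$ are the $0/1$ matrices with $(A_i)_{xy}=1$ if and only if $(x,y)\in R_i$. Their span $M$ is a commutative algebra of dimension $D+1$, closed under the entrywise product $\circ$. It has a unique basis (up to order) of primitive idempotents, i.e. matrices $E_0,\dots,E_D$ with $E_iE_j=\delta_{ij}E_i$ and $\sum_i E_i=I$; in any ordering $E_0,\dots,E_D$ it is understood that $E_0=|X|^{-1}J$, where $J$ is the all-ones matrix. The multiplicity $m_i$ is $\operatorname{rank}(E_i)=\dim(E_iV)$, where $V=\mathbb{C}^X$.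 $Q$-polynomial. The Krein parameters $q^h_{ij}$ are defined by $E_i\circ E_j=|X|^{-1}\sum_{h=0}^D q^h_{ij}E_h$. $Y$ is $Q$-polynomial with respect to the ordering $E_0,\dots,E_D$ if for all $h,i,j\in\{0,\dots,D\}$: $q^h_{ij}=0$ whenever one of $h,i,j$ is greater than the sum of the other two, and $q^h_{ij}\ne 0$ whenever one of $h,i,j$ equals the sum of the other two. Terwilliger algebra and dual-thinness. For $x\in X$ and $0\le i\le D$, let $E_i^*=E_i^*(x)\in\mathrm{Mat}_X(\mathbb{C})$ be the diagonal matrix whose $(y,y)$ entry is $1$ if $(x,y)\in R_i$ and $0$ otherwise. The Terwilliger algebra $T=T(x)$ is the subalgebra of $\mathrm{Mat}_X(\mathbb{C})$ generated by $A_0,\dots,A_D,E_0^*,\dots,E_D^*$. It acts on $V=\mathbb{C}^X$ by matrix multiplication. A $T$-module is a subspace $W\subseteq V$ with $TW\subseteq W$; it is irreducible if $W\neq 0$ and its only $T$-submodules are $0$ and $W$. An irreducible $T$-module $W$ is dual-thin if $\dim(E_iW)\le 1$ for all $0\le i\le D$. The scheme $Y$ is dual-thin if, for every $x\in X$, every irreducible $T(x)$-module is dual-thin. *)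

(* Defs.v *)
From HB Require Import structures.
From mathcomp Require Import all_boot all_order all_algebra.
From mathcomp Require Export reals.
From mathcomp.real_closed Require Export complex.

Set Implicit Arguments.
Unset Strict Implicit.
Unset Printing Implicit Defensive.

Import Order.TTheory GRing.Theory Num.Theory.
Local Open Scope ring_scope.

Record assoc_scheme (X : finType) (D : nat) := AssocScheme {
  srel :> 'I_D.+1 -> rel X;
  scheme_classes : (0 < D)%N;
  scheme_points : (0 < #|X|)%N;
  scheme_nonempty : forall i, exists x y, srel i x y;
  scheme_sym : forall i x y, srel i x y = srel i y x;
  scheme_partition : forall x y, exists! i, srel i x y;
  scheme_diag : forall x y, srel ord0 x y = (x == y);
  scheme_intersection : forall h i j, exists p : nat,
    forall x y, srel h x y -> #|[set z | srel i x z && srel j z y]| = p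
}.

(* Mat_X(C) is 'M[C]_#|X| and C^X is 'cV[C]_#|X|, a point x : X being the
   index enum_rank x. *)

Definition assoc_mx (C : fieldType) (X : finType) (D : nat)
    (Y : assoc_scheme X D) (i : 'I_D.+1) : 'M[C]_#|X| :=
  \matrix_(a, b) (Y i (enum_val a) (enum_val b))%:R.

Definition bose_mesner (C : fieldType) (X : finType) (D : nat)
    (Y : assoc_scheme X D) : {vspace 'M[C]_#|X|} :=
  <<[tuple assoc_mx C Y i | i < D.+1]>>%VS.

Record idempotent_ordering (C : fieldType) (X : finType) (D : nat)
    (Y : assoc_scheme X D) (E : 'I_D.+1 -> 'M[C]_#|X|) : Prop :=
  IdempotentOrdering {
  idem_basis : basis_of (bose_mesner C Y) [tuple E i | i < D.+1];
  idem_orth : forall i j, E i *m E j = if i == j then E i else 0;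
  idem_sum : \sum_i E i = 1%:M;
  idem_0 : E ord0 = (#|X|%:R)^-1 *: const_mx 1
}.

(* q h i j stands for q^h_{ij}. When E is a basis closed under the entrywise
   product, this equation determines q uniquely. *)
Definition krein_parameters (C : fieldType) (X : finType) (D : nat)
    (E : 'I_D.+1 -> 'M[C]_#|X|) (q : 'I_D.+1 -> 'I_D.+1 -> 'I_D.+1 -> C) :
    Prop :=
  forall i j,
    map2_mx *%R (E i) (E j) = (#|X|%:R)^-1 *: \sum_h q h i j *: E h.

Definition Q_polynomial (C : fieldType) (X : finType) (D : nat)
    (Y : assoc_scheme X D) (E : 'I_D.+1 -> 'M[C]_#|X|) : Prop :=
  idempotent_ordering Y E /\
  exists2 q, krein_parameters E q &
    forall h i j : 'I_D.+1,
      ([|| i + j < h, h + j < i | h + i < j]%N -> q h i j = 0) /\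
      ([|| h == i + j :> nat, i == h + j :> nat | j == h + i :> nat]%N ->
         q h i j <> 0).

Definition dual_idem (C : fieldType) (X : finType) (D : nat)
    (Y : assoc_scheme X D) (x : X) (i : 'I_D.+1) : 'M[C]_#|X| :=
  diag_mx (\row_a (Y i x (enum_val a))%:R).

Inductive gen_alg (C : fieldType) (n : nat) (S : 'M[C]_n -> Prop) :
    'M[C]_n -> Prop :=
  | gen_alg_in B : S B -> gen_alg S B
  | gen_alg_1 : gen_alg S 1%:M
  | gen_alg_add B B' : gen_alg S B -> gen_alg S B' -> gen_alg S (B + B')
  | gen_alg_scale c B : gen_alg S B -> gen_alg S (c *: B)
  | gen_alg_mul B B' : gen_alg S B -> gen_alg S B' -> gen_alg S (B *m B').

Definition terwilliger (C : fieldType) (X : finType) (D : nat)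
    (Y : assoc_scheme X D) (x : X) : 'M[C]_#|X| -> Prop :=
  gen_alg (fun B => exists i, B = assoc_mx C Y i \/ B = dual_idem C Y x i).

Definition is_module (C : fieldType) (n : nat) (T : 'M[C]_n -> Prop)
    (W : {vspace 'cV[C]_n}) : Prop :=
  forall B w, T B -> w \in W -> B *m w \in W.

Definition irreducible_module (C : fieldType) (n : nat) (T : 'M[C]_n -> Prop)
    (W : {vspace 'cV[C]_n}) : Prop :=
  [/\ is_module T W, W <> 0%VS &
      forall U : {vspace 'cV[C]_n},
        is_module T U -> (U <= W)%VS -> U = 0%VS \/ U = W].

Definition dual_thin_module (C : fieldType) (n D : nat)
    (E : 'I_D.+1 -> 'M[C]_n) (W : {vspace 'cV[C]_n}) : Prop :=
  forall i, (\dim (linfun (mulmx (E i)) @: W)%VS <= 1)%N.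

Definition dual_thin (C : fieldType) (X : finType) (D : nat)
    (Y : assoc_scheme X D) (E : 'I_D.+1 -> 'M[C]_#|X|) : Prop :=
  forall (x : X) (W : {vspace 'cV[C]_#|X|}),
    irreducible_module (terwilliger Y x) W -> dual_thin_module E W.

(* Main.v *)
Require Import Defs.
From HB Require Import structures.
From mathcomp Require Import all_boot all_order all_algebra.
From mathcomp Require Import boolp ring zify.

Set Implicit Arguments.
Unset Strict Implicit.
Unset Printing Implicit Defensive.

Import Order.TTheory GRing.Theory Num.Theory.
Local Open Scope ring_scope.
Local Open Scope sesquilinear_scope.

(* Fix a base point x.  Since T = T(x) is closed under conjugate transposition,
   C^X is an orthogonal sum of irreducible T-modules W, and m_i is the sum of
   the dimensions of the E_i W, each of which is at most 1.  So it suffices that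
   E_i W <> 0 forces E_k W <> 0 for i <= k <= D - i.  First, E_h W <> 0 for some
   h >= D - i: otherwise A*_D kills E_i W, because E_h A*_D E_i = 0 for
   h < D - i; the three-term recurrence for A*_1 A*_j, read downwards from
   j = D, then gives A*_j (E_i W) = 0 for all j, which is absurd for A*_0 = I.
   Second, the set of h with E_h W <> 0 is an interval: A*_1 generates the dual
   Bose-Mesner algebra and acts tridiagonally on the E_h W, so a gap would
   split W. *)

(** * Ranks, spans and generated algebras *)

Lemma dim_limg_mulmx (F : fieldType) m n (A : 'M[F]_(m, n)) :
  \dim (limg (linfun (mulmx A : 'cV_n -> 'cV_m))) = \rank A.
Proof.
have [B rB] := row_freeP (row_base_free A).
have [B' cB] := row_fullP (col_base_full A).
pose f := linfun (mulmx (col_base A) : 'cV_(\rank A) -> 'cV_m).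
(* Since [row_base A] has the right inverse [B], the image of [A] is that of [col_base A], which is
   injective. *)
have -> : limg (linfun (mulmx A : 'cV_n -> 'cV_m)) = limg f.
  apply/eqP; rewrite eqEsubv.
  apply/andP; split; apply/subvP => v /memv_imgP[u _ ->].
    rewrite lfunE /= -[in X in X *m u](mulmx_base A) -mulmxA.
    by apply/memv_imgP; exists (row_base A *m u); rewrite ?memvf// lfunE.
  apply/memv_imgP; exists (B *m u); rewrite ?memvf// !lfunE /=.
  have cbE : col_base A = A *m B.
    by have := congr1 (mulmx^~ B) (mulmx_base A); rewrite -mulmxA rB mulmx1.
  by rewrite mulmxA -cbE.
rewrite limg_dim_eq ?dimvf ?dim_matrix ?mulr1//.
apply/eqP; rewrite -subv0; apply/subvP => v.
rewrite memv_cap memv_ker lfunE /= => /andP[_ /eqP fv0].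
by rewrite memv0 -[v]mul1mx -cB -mulmxA fv0 mulmx0.
Qed.

Lemma span_mktupleP (F : fieldType) (vT : vectType F) n (f : 'I_n -> vT) v :
  v \in <<[tuple f i | i < n]>>%VS -> exists c, v = \sum_i c i *: f i.
Proof.
move=> /coord_span ->; eexists => //.
by apply: eq_bigr => i _; rewrite -tnth_nth tnth_mktuple.
Qed.

Lemma gen_alg_sum (F : fieldType) n (S : 'M[F]_n -> Prop) I (r : seq I)
    (c : I -> F) (M : I -> 'M[F]_n) :
  (forall i, gen_alg S (M i)) -> gen_alg S (\sum_(i <- r) c i *: M i).
Proof.
move=> SM; apply: (big_ind (gen_alg S)) => [|A B|i _].
- rewrite -(scale0r 1%:M); exact/gen_alg_scale/gen_alg_1.
- exact: gen_alg_add.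
- exact/gen_alg_scale.
Qed.

(** * Conjugate transposition and complete reducibility *)

Section Adjoint.
Variable C : numClosedFieldType.

Lemma adjmxM m n p (A : 'M[C]_(m, n)) (B : 'M[C]_(n, p)) :
  (A *m B)^t* = B^t* *m A^t*.
Proof. by rewrite trmx_mul map_mxM. Qed.

Lemma adjmxZ m n (c : C) (A : 'M[C]_(m, n)) : (c *: A)^t* = c^* *: A^t*.
Proof. by rewrite linearZ /= map_mxZ. Qed.

Lemma mxtrace_adjmx_mul m n (A : 'M[C]_(m, n)) :
  \tr (A^t* *m A) = \sum_j \sum_i `|A i j| ^+ 2.
Proof.
apply: eq_bigr => j _; rewrite mxE; apply: eq_bigr => i _.
by rewrite !mxE mulrC normCK.
Qed.

Lemma mxtrace_adjmx_mul_eq0 m n (A : 'M[C]_(m, n)) :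
  \tr (A^t* *m A) = 0 -> A = 0.
Proof.
rewrite mxtrace_adjmx_mul => tr0; apply/matrixP => i j; rewrite mxE.
have ge0 k l : 0 <= `|A k l| ^+ 2 by rewrite exprn_ge0.
have /psumr_eq0P col0 := tr0.
have := col0 (fun l _ => sumr_ge0 _ (fun k _ => ge0 k l)) j isT.
move/psumr_eq0P => /(_ (fun k _ => ge0 k j)) /(_ i isT) /eqP.
by rewrite expf_eq0 /= normr_eq0 => /eqP.
Qed.

Lemma adjmx_mul_eq0 m n (A : 'M[C]_(m, n)) : A^t* *m A = 0 -> A = 0.
Proof. by move=> A0; apply: mxtrace_adjmx_mul_eq0; rewrite A0 mxtrace0. Qed.

Lemma gen_alg_adj n (S : 'M[C]_n -> Prop) :
  (forall B, S B -> S (B^t* )) -> forall B, gen_alg S B -> gen_alg S (B^t* ).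
Proof.
move=> Sadj B; elim=> {B} [B SB||B B' _ IH _ IH'|c B _ IH|B B' _ IH _ IH'].
- exact/gen_alg_in/Sadj.
- rewrite trmx1 map_mx1; exact: gen_alg_1.
- rewrite linearD /= map_mxD; exact: gen_alg_add.
- rewrite adjmxZ; exact: gen_alg_scale.
- rewrite adjmxM; exact: gen_alg_mul.
Qed.

(** With a basis of W as the columns of [B], W' is the kernel of [B^t*]. Positivity of v^* v makes
    the two disjoint, and rank-nullity makes them fill the space. *)
Lemma orthocomplement_exists n (W : {vspace 'cV[C]_n}) :
  exists2 W' : {vspace 'cV[C]_n},
    (forall u, u \in W' <-> forall w, w \in W -> w^t* *m u = 0) &
    (W :&: W' = 0 /\ W + W' = fullv)%VS.
Proof.
pose B := \matrix_(a < n, b < \dim W) (vbasis W)`_b a ord0.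
have colB b : col b B = (vbasis W)`_b.
  by apply/matrixP => a c; rewrite !mxE (ord1 c).
have inW w : w \in W -> exists c, w = B *m c.
  move=> /(coord_basis (vbasisP W)) wE; exists (\col_b coord (vbasis W) b w).
  rewrite [LHS]wE; apply/matrixP => a c; rewrite summxE !mxE ord1.
  by apply: eq_bigr => b _; rewrite !mxE mulrC.
pose f := linfun (mulmx (B^t* ) : 'cV_n -> 'cV_(\dim W)).
have kerP u : u \in lker f <-> forall w, w \in W -> w^t* *m u = 0.
  rewrite memv_ker lfunE /=; split=> [/eqP Bu0 w /inW[c ->]|Wu0].
    by rewrite adjmxM -mulmxA Bu0 mulmx0.
  apply/eqP/row_matrixP => b; rewrite row0 row_mul -map_row -tr_col colB Wu0//.
  by rewrite vbasis_mem// mem_nth// size_tuple.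
have cap0 : (W :&: lker f = 0)%VS.
  apply/eqP; rewrite -subv0; apply/subvP => v.
  rewrite memv_cap => /andP[vW /kerP vv].
  by rewrite memv0; apply/eqP/adjmx_mul_eq0/vv.
exists (lker f) => //; split=> //; apply/eqP; rewrite eqEdim subvf /=.
rewrite dimv_disjoint_sum// addnC -(limg_ker_dim f fullv) capfv leq_add2l.
by rewrite (leq_trans (dimvS (subvf _)))// dimvf dim_matrix mulr1.
Qed.

(* Cutting U by the orthogonal complement of a submodule keeps it a module
   because T is closed under conjugate transposition. *)
Lemma module_complement n (T : 'M[C]_n -> Prop) (U W : {vspace 'cV[C]_n}) :
  (forall B, T B -> T (B^t* )) -> is_module T U -> is_module T W ->
  (W <= U)%VS ->
  exists2 W', is_module T W' & (W :&: W' = 0 /\ W + W' = U)%VS.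
Proof.
move=> Tadj Umod Wmod sWU; have [P PP [cap0 sumf]] := orthocomplement_exists W.
exists (P :&: U)%VS; last first.
  by rewrite capvA cap0 cap0v vspace_modl// sumf capfv.
move=> B w TB; rewrite !memv_cap => /andP[/PP wP wU]; rewrite Umod// andbT.
apply/PP => v vW; rewrite mulmxA.
by have := wP _ (Wmod _ v (Tadj _ TB) vW); rewrite adjmxM trmxCK.
Qed.

Lemma dim_limg_module_sum n (A : 'M[C]_n) (U W : {vspace 'cV[C]_n}) :
  (forall w, w \in U -> A *m w \in U) -> (forall w, w \in W -> A *m w \in W) ->
  (U :&: W = 0)%VS ->
  \dim (linfun (mulmx A) @: (U + W)) =
    (\dim (linfun (mulmx A) @: U) + \dim (linfun (mulmx A) @: W))%N.
Proof.
move=> UA WA cap0; rewrite limgD dimv_disjoint_sum//.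
have img (Z : {vspace 'cV[C]_n}) : (forall w, w \in Z -> A *m w \in Z) ->
    (linfun (mulmx A : 'cV_n -> 'cV_n) @: Z <= Z)%VS.
  by move=> ZA; apply/subvP => v /memv_imgP[u uZ ->]; rewrite lfunE /= ZA.
by apply/eqP; rewrite -subv0 -cap0 capvS// img.
Qed.

(** Induction on dim U replaces a full decomposition into irreducibles: a reducible U splits into
    two smaller submodules, and the dimensions of their images under [A] and [B] add up. *)
Lemma module_dim_le n (T : 'M[C]_n -> Prop) (A B : 'M[C]_n) :
  (forall M, T M -> T (M^t* )) -> T A -> T B ->
  (forall W, irreducible_module T W ->
     (\dim (linfun (mulmx A) @: W) <= \dim (linfun (mulmx B) @: W))%N) ->
  forall U, is_module T U ->
    (\dim (linfun (mulmx A) @: U) <= \dim (linfun (mulmx B) @: U))%N.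
Proof.
move=> Tadj TA TB irr U; have [d] := ubnP (\dim U).
elim: d U => // d IH U dU Umod.
have [->|/eqP U0] := eqVneq U 0%VS; first by rewrite !limg0.
have [/irr//|red] := pselect (irreducible_module T U).
(* By excluded middle, a nonzero module that is not irreducible has a proper nonzero submodule. *)
have [W [Wmod sWU W0 WU]] :
    exists W, [/\ is_module T W, (W <= U)%VS, W <> 0%VS & W <> U].
  apply: contrapT => noW; apply: red; split=> // W Wmod sWU.
  apply: contrapT => W0U; apply: noW; exists W.
  by split=> // eqW; apply: W0U; [left | right].
have [W' W'mod [cap0 WW'U]] := module_complement Tadj Umod Wmod sWU.
have dWW' : \dim U = (\dim W + \dim W')%N by rewrite -dimv_disjoint_sum// WW'U.
have lt0W : (0 < \dim W)%N by rewrite lt0n dimv_eq0; apply/eqP.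
have ltWU : (\dim W < \dim U)%N.
  by rewrite ltn_neqAle (dimvS sWU) andbT (dimv_leqif_eq sWU); apply/eqP.
have stab (V : {vspace 'cV[C]_n}) M :
    is_module T V -> T M -> forall w, w \in V -> M *m w \in V.
  by move=> Vmod TM w; apply: Vmod.
rewrite -WW'U !dim_limg_module_sum; try by [|exact: stab].
apply: leq_add; apply: IH => //; first exact: leq_trans ltWU _.
rewrite -ltnS; apply: leq_trans dU; rewrite ltnS dWW'.
by rewrite -[X in (X < _)%N]add0n ltn_add2r.
Qed.

End Adjoint.

(** * The Bose-Mesner algebra, its dual and the Terwilliger algebra *)

Section BoseMesner.
Variables (C : numClosedFieldType) (X : finType) (D : nat).
Variable Y : assoc_scheme X D.

Lemma assoc_mx_mem i : assoc_mx C Y i \in bose_mesner C Y.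
Proof.
by apply: memv_span; rewrite -(tnth_mktuple (assoc_mx C Y)) mem_tnth.
Qed.

Lemma assoc_mx_tr i : (assoc_mx C Y i)^T = assoc_mx C Y i.
Proof. by apply/matrixP => a b; rewrite !mxE scheme_sym. Qed.

Lemma assoc_mx_adj i : (assoc_mx C Y i)^t* = assoc_mx C Y i.
Proof.
by rewrite assoc_mx_tr; apply/matrixP => a b; rewrite !mxE conjC_nat.
Qed.

Lemma bose_mesner_tr M : M \in bose_mesner C Y -> M^T = M.
Proof.
move=> /span_mktupleP[c ->]; rewrite linear_sum; apply: eq_bigr => i _.
by rewrite linearZ /= assoc_mx_tr.
Qed.

Lemma bose_mesner_adj M : M \in bose_mesner C Y -> M^t* \in bose_mesner C Y.
Proof.
move=> /span_mktupleP[c ->]; rewrite raddf_sum raddf_sum memv_suml// => i _.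
by rewrite /= adjmxZ assoc_mx_adj memvZ// assoc_mx_mem.
Qed.

Lemma dual_idem_adj x i : (dual_idem C Y x i)^t* = dual_idem C Y x i.
Proof.
rewrite tr_diag_mx; apply/matrixP => a b; rewrite !mxE.
by case: (a == b); rewrite ?mulr1n ?mulr0n ?conjC_nat// conjC0.
Qed.

(** All generators are real symmetric. This closure is what allows modules to be split
    orthogonally. *)
Lemma terwilliger_adj x (B : 'M[C]_#|X|) :
  terwilliger Y x B -> terwilliger Y x (B^t* ).
Proof.
apply: gen_alg_adj => {}B [i [->|->]]; exists i.
  by left; rewrite assoc_mx_adj.
by right; rewrite dual_idem_adj.
Qed.

(* [dual_mx x (E i)] is the dual associate matrix A*_i(x) divided by |X|. *)
Definition dual_mx (x : X) (M : 'M[C]_#|X|) : 'M[C]_#|X| :=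
  diag_mx (row (enum_rank x) M).

Lemma dual_mx_sum x I (r : seq I) (c : I -> C) (M : I -> 'M[C]_#|X|) :
  dual_mx x (\sum_(i <- r) c i *: M i) = \sum_(i <- r) c i *: dual_mx x (M i).
Proof.
by rewrite /dual_mx !linear_sum /=; apply: eq_bigr => i _; rewrite !linearZ.
Qed.

Lemma dual_mx_assoc x i : dual_mx x (assoc_mx C Y i) = dual_idem C Y x i.
Proof.
by congr diag_mx; apply/matrixP => a b; rewrite !mxE enum_rankK.
Qed.

Lemma terwilliger_bose_mesner x M : M \in bose_mesner C Y -> terwilliger Y x M.
Proof.
move=> /span_mktupleP[c ->]; apply: gen_alg_sum => i.
by apply: gen_alg_in; exists i; left.
Qed.

(** By linearity, [dual_mx] turns an expansion in the A_i into one in the E*_i. *)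
Lemma terwilliger_dual_mx x M :
  M \in bose_mesner C Y -> terwilliger Y x (dual_mx x M).
Proof.
move=> /span_mktupleP[c ->]; rewrite dual_mx_sum; apply: gen_alg_sum => i.
by apply: gen_alg_in; exists i; right; rewrite dual_mx_assoc.
Qed.

End BoseMesner.

(** * Primitive idempotents *)

Section Idempotents.
Variables (C : numClosedFieldType) (X : finType) (D : nat).
Variables (Y : assoc_scheme X D) (E : 'I_D.+1 -> 'M[C]_#|X|).
Hypothesis idemE : idempotent_ordering Y E.

Lemma idem_mem i : E i \in bose_mesner C Y.
Proof.
rewrite -(span_basis (idem_basis idemE)) memv_span//.
by rewrite -(tnth_mktuple E) mem_tnth.
Qed.

Lemma idem_spanP M : M \in bose_mesner C Y -> exists c, M = \sum_i c i *: E i.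
Proof.
by rewrite -(span_basis (idem_basis idemE)) => /span_mktupleP.
Qed.

Lemma idem_neq0 i : E i != 0.
Proof.
have /free_not0 := basis_free (idem_basis idemE).
by apply; rewrite -(tnth_mktuple E) mem_tnth.
Qed.

Lemma idem_tr i : (E i)^T = E i.
Proof. exact/(bose_mesner_tr (Y := Y))/idem_mem. Qed.

Lemma bose_mesner_mul_idem M k : M \in bose_mesner C Y ->
  exists c, M *m E k = c *: E k.
Proof.
move=> /idem_spanP[c ->]; exists (c k); rewrite mulmx_suml.
rewrite (bigD1 k)//= -scalemxAl (idem_orth idemE) eqxx big1 ?addr0// => j.
by move=> /negPf jk; rewrite -scalemxAl (idem_orth idemE) jk scaler0.
Qed.

(** The adjoint of E_i lies in the Bose-Mesner algebra, so it acts on each E_k as a scalar. For k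
    different from i, computing E_k^* E_i E_k in two ways makes that scalar 0, since E_k^* E_k is
    nonzero. Hence E_i^* = c E_i, and idempotence leaves only c = 1. *)
Lemma idem_adj i : (E i)^t* = E i.
Proof.
have adjE0 k : (E k)^t* *m E k <> 0.
  by move/adjmx_mul_eq0/eqP; rewrite (negPf (idem_neq0 k)).
have mem := bose_mesner_adj (idem_mem i).
have off k : k != i -> (E i)^t* *m E k = 0.
  move=> ki; have [d dE] := bose_mesner_mul_idem k mem.
  have : (E k)^t* *m E i *m E k = d^* *: ((E k)^t* *m E k).
    have <- : ((E i)^t* *m E k)^t* = (E k)^t* *m E i by rewrite adjmxM trmxCK.
    by rewrite dE adjmxZ scalemxAl.
  rewrite -mulmxA (idem_orth idemE) eq_sym (negPf ki) mulmx0 => /esym/eqP.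
  rewrite scaler_eq0 conjC_eq0 => /orP[/eqP d0|/eqP/adjE0//].
  by rewrite dE d0 scale0r.
have [c cE] := bose_mesner_mul_idem i mem.
have adjE : (E i)^t* = c *: E i.
  rewrite -[LHS]mulmx1 -(idem_sum idemE) mulmx_sumr (bigD1 i)//= big1 ?addr0//.
have : (E i)^t* *m (E i)^t* = (E i)^t*.
  by rewrite -adjmxM (idem_orth idemE) eqxx.
rewrite {1}adjE adjE -scalemxAl -scalemxAr (idem_orth idemE) eqxx scalerA.
move=> /eqP; rewrite -subr_eq0 -scalerBl scaler_eq0 (negPf (idem_neq0 i)) orbF.
rewrite -{3}(mulr1 c) -mulrBr mulf_eq0 subr_eq0 => /orP[/eqP c0|/eqP ->].
  by case: (adjE0 i); rewrite cE c0 scale0r.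
by rewrite scale1r.
Qed.

(** * Krein parameters and the products E_h A*_j E_i *)

Section Krein.
Variable q : 'I_D.+1 -> 'I_D.+1 -> 'I_D.+1 -> C.
Hypothesis kreinE : krein_parameters E q.

(** Diagonal matrices multiply entrywise, so this is row x of the Krein equation. *)
Lemma dual_mx_mul x i j :
  dual_mx x (E i) *m dual_mx x (E j) =
    (#|X|%:R)^-1 *: \sum_h q h i j *: dual_mx x (E h).
Proof.
rewrite -dual_mx_sum.
have -> (c : C) M : c *: dual_mx x M = dual_mx x (c *: M).
  by rewrite /dual_mx !linearZ.
rewrite -kreinE mulmx_diag; congr diag_mx.
by apply/matrixP => a b; rewrite !mxE.
Qed.

(* The squared Frobenius norm of E_h A*_j E_i is a multiple of the (x,x) entry
   of E_j (E_h o E_i) E_j, and E_j (E_h o E_i) is a multiple of q^j_{hi}. *)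
Lemma idem_dual_mx_idem_eq0 x h j i :
  q j h i = 0 -> E h *m dual_mx x (E j) *m E i = 0.
Proof.
move=> q0; apply: mxtrace_adjmx_mul_eq0.
have had0 : map2_mx *%R (E h) (E i) *m E j = 0.
  rewrite kreinE -scalemxAl mulmx_suml big1 ?scaler0// => k _.
  rewrite -scalemxAl (idem_orth idemE).
  case: eqP => [->|_]; last by rewrite scaler0.
  by rewrite q0 scale0r.
have EhE k : E k *m E k = E k by rewrite (idem_orth idemE) eqxx.
pose F := dual_mx x (E j).
set A := _ *m _ *m _.
have -> : A^t* *m A = E i *m (F^t* *m E h *m F *m E i).
  by rewrite /A !adjmxM !idem_adj !mulmxA -(mulmxA _ (E h) (E h)) EhE.
have FE : F^t* = diag_mx (\row_a E j a (enum_rank x)).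
  rewrite /F /dual_mx tr_diag_mx map_diag_mx; congr diag_mx.
  by apply/matrixP => a b; rewrite !mxE -[in RHS]idem_adj !mxE.
rewrite mxtrace_mulC -(mulmxA _ (E i) (E i)) EhE FE.
rewrite /F /dual_mx mul_diag_mx mul_mx_diag.
pose ix := enum_rank x.
transitivity ((E j *m (map2_mx *%R (E h) (E i) *m E j)) ix ix).
  rewrite mxE /mxtrace; under [RHS]eq_bigr do rewrite mxE mulr_sumr.
  rewrite exchange_big; apply: eq_bigr => a _; rewrite mxE.
  apply: eq_bigr => b _.
  rewrite !mxE -[in X in _ = _ * (X * _ * _)]idem_tr mxE mulrC.
  by ring.
by rewrite had0 mulmx0 mxE.
Qed.

(** * The three-term recurrence and the dual support of a module *)

Section QPolynomial.
Hypothesis qE : forall h i j : 'I_D.+1,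
  ([|| i + j < h, h + j < i | h + i < j]%N -> q h i j = 0) /\
  ([|| h == i + j :> nat, i == h + j :> nat | j == h + i :> nat]%N ->
     q h i j <> 0).

(** This index really is 1 because D >= 1; out of range, [inord] would give 0. *)
Let one : 'I_D.+1 := inord 1.

Let val_one : one = 1%N :> nat.
Proof. by rewrite inordK// ltnS (scheme_classes Y). Qed.

Let card_neq0 : (#|X|%:R : C) != 0.
Proof. by rewrite pnatr_eq0 -lt0n (scheme_points Y). Qed.

Lemma dual_mx_idem0 x : dual_mx x (E ord0) = (#|X|%:R)^-1 *: 1%:M.
Proof.
rewrite (idem_0 idemE); apply/matrixP => a b; rewrite !mxE.
by rewrite mulr1 mulr_natr.
Qed.

Lemma dual_mx_last_inj x (v : 'cV[C]_#|X|) :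
  dual_mx x (E ord_max) *m v = 0 -> v = 0.
Proof.
move=> vD; have F0 k : (k <= D)%N ->
    forall h : 'I_D.+1, (D - k <= h)%N -> dual_mx x (E h) *m v = 0.
  elim: k => [_ h Dh|k IH kD h Dkh].
    suff -> : h = ord_max by [].
    by apply/val_inj => /=; have := ltn_ord h; lia.
  have [Dh|hD] := leqP (D - k) h; first by apply: IH => //; lia.
  (* Here h = D - k - 1. In the expansion of A*_1 A*_{h+1} v, the terms above h vanish by induction
     and those below h by the triangle condition, so only the multiple q^h_{1,h+1} A*_h v remains,
     with a nonzero coefficient. *)
  have hS : (h.+1 < D.+1)%N by lia.
  pose j := Ordinal hS.
  have := congr1 (mulmx^~ v) (dual_mx_mul x one j).
  rewrite -mulmxA IH ?mulmx0 /=; [|lia..].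
  rewrite -scalemxAl mulmx_suml => /esym/eqP.
  rewrite scaler_eq0 invr_eq0 (negPf card_neq0) /= (bigD1 h)//= big1 ?addr0.
    rewrite -scalemxAl scaler_eq0 => /orP[/eqP q0|/eqP//].
    by case: ((qE h one j).2 _ q0); rewrite val_one /=; lia.
  move=> l lh; rewrite -scalemxAl.
  have [hl|lh'] := leqP (D - k) l; first by rewrite IH ?scaler0//; lia.
  have -> : q l one j = 0; last by rewrite scale0r.
  apply: (qE l one j).1; rewrite val_one /=.
  by move: lh; rewrite -(inj_eq val_inj) /=; lia.
have := F0 D (leqnn _) ord0; rewrite subnn => /(_ isT).
rewrite dual_mx_idem0 -scalemxAl mul1mx => /eqP.
by rewrite scaler_eq0 invr_eq0 (negPf card_neq0) => /eqP.
Qed.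

(** The recurrence, read upwards from A*_0, produces every A*_j from A*_1. Together with the E_i
    these span all generators of T. *)
Lemma is_module_terwilliger x (W : {vspace 'cV[C]_#|X|}) :
  (forall i w, w \in W -> E i *m w \in W) ->
  (forall w, w \in W -> dual_mx x (E one) *m w \in W) ->
  is_module (terwilliger Y x) W.
Proof.
move=> WE WF1.
have WF k : forall j : 'I_D.+1, (j <= k)%N ->
    forall w, w \in W -> dual_mx x (E j) *m w \in W.
  elim: k => [|k IH] j jk w wW.
    have -> : j = ord0 by apply/val_inj => /=; lia.
    by rewrite dual_mx_idem0 -scalemxAl mul1mx memvZ.
  have [jk'|kj] := leqP j k; first exact: IH.
  have kD : (k < D.+1)%N by have := ltn_ord j; lia.
  pose i := Ordinal kD.
  have := congr1 (mulmx^~ w) (dual_mx_mul x one i).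
  rewrite -mulmxA -scalemxAl mulmx_suml (bigD1 j)//= -scalemxAl.
  (* Here j = k + 1 and i = k. In [u], the terms with l <= k lie in W by induction and those with l
     > k + 1 vanish, so the recurrence can be solved for A*_j w. *)
  set u := \sum_(_ | _) _ => FE.
  have uW : u \in W.
    apply: memv_suml => l lj; rewrite -scalemxAl.
    have [lk|kl] := leqP l k; first by rewrite memvZ// IH.
    rewrite (qE l one i).1 ?scale0r ?mem0v// val_one /=.
    by move: lj; rewrite -(inj_eq val_inj) /=; lia.
  have qj : q j one i != 0.
    by apply/eqP; apply: (qE j one i).2; rewrite val_one /=; lia.
  have -> : dual_mx x (E j) *m w =
      (q j one i)^-1 *:
        (#|X|%:R *: (dual_mx x (E one) *m (dual_mx x (E i) *m w)) - u).
    by rewrite FE scalerA mulfV// scale1r addrK scalerA mulVf// scale1r.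
  by rewrite memvZ// memvB// memvZ// WF1// IH.
move=> B w TB.
elim: TB w => {B} [B [i BE]||B B' _ IH _ IH'|c B _ IH|B B' _ IH _ IH'] w wW.
(* The same coefficients expand A_i in the E_j and E*_i in the [dual_mx x (E j)]. *)
- have [c cE] := idem_spanP (assoc_mx_mem C Y i).
  case: BE => ->; rewrite -?dual_mx_assoc cE ?dual_mx_sum mulmx_suml.
    by apply: memv_suml => j _; rewrite -scalemxAl memvZ// WE.
  by apply: memv_suml => j _; rewrite -scalemxAl memvZ// (WF j).
- by rewrite mul1mx.
- by rewrite mulmxDl memvD ?IH ?IH'.
- by rewrite -scalemxAl memvZ// IH.
- by rewrite -mulmxA IH// IH'.
Qed.

Lemma module_idem x (W : {vspace 'cV[C]_#|X|}) i w :
  is_module (terwilliger Y x) W -> w \in W -> E i *m w \in W.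
Proof. by apply; apply/terwilliger_bose_mesner/idem_mem. Qed.

Lemma module_dual_mx x (W : {vspace 'cV[C]_#|X|}) i w :
  is_module (terwilliger Y x) W -> w \in W -> dual_mx x (E i) *m w \in W.
Proof. by apply; apply/terwilliger_dual_mx/idem_mem. Qed.

Lemma sum_idem_mul (w : 'cV[C]_#|X|) : w = \sum_h E h *m w.
Proof. by rewrite -mulmx_suml (idem_sum idemE) mul1mx. Qed.

Lemma dual_support_reflect x (W : {vspace 'cV[C]_#|X|}) (i : 'I_D.+1) w :
  is_module (terwilliger Y x) W -> w \in W -> E i *m w != 0 ->
  exists2 h : 'I_D.+1, (D - i <= h)%N & exists2 u, u \in W & E h *m u != 0.
Proof.
move=> Wmod wW Eiw; apply: contrapT => noh; case/eqP: Eiw.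
apply: (@dual_mx_last_inj x); rewrite [LHS]sum_idem_mul big1// => h _.
(* For h >= D - i the term vanishes by the contrary assumption, applied to A*_D E_i w in W; for h +
   i < D it vanishes because q^D_{hi} = 0. *)
have [Dh|hD] := leqP (D - i) h.
  apply/eqP/negPn/negP => Eh; apply: noh; exists h => //.
  eexists; last exact: Eh.
  exact: (module_dual_mx _ Wmod (module_idem _ Wmod _)).
rewrite !mulmxA idem_dual_mx_idem_eq0 ?mul0mx//.
by apply: (qE ord_max h i).1; apply/orP; left => /=; lia.
Qed.

Lemma dual_support_interval x (W : {vspace 'cV[C]_#|X|}) (i j k : 'I_D.+1) w u :
  irreducible_module (terwilliger Y x) W -> (i < j)%N -> (j < k)%N ->
  w \in W -> E i *m w != 0 -> u \in W -> E k *m u != 0 ->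
  exists2 v, v \in W & E j *m v != 0.
Proof.
move=> [Wmod _ Wirr] ij jk wW Eiw uW Eku; apply: contrapT => noj.
have Ej v : v \in W -> E j *m v = 0.
  by move=> vW; apply/eqP/negPn/negP => Ejv; apply: noj; exists v.
pose P := \sum_(h : 'I_D.+1 | (j < h)%N) E h.
have EP h : E h *m P = if (j < h)%N then E h else 0.
  rewrite mulmx_sumr; case: ifP => jh.
    rewrite (bigD1 h)//= (idem_orth idemE) eqxx big1 ?addr0//.
    by move=> l /andP[_ /negPf lh]; rewrite (idem_orth idemE) eq_sym lh.
  rewrite big1// => l jl; rewrite (idem_orth idemE); case: eqP => // hl.
  by move: jl; rewrite -hl jh.
(* The part of W supported on indices up to j. The gap at j will make it a submodule. *)
pose U := (W :&: lker (linfun (mulmx P : 'cV_#|X| -> 'cV_#|X|)))%VS.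
have UP v : v \in U <->
    v \in W /\ forall h : 'I_D.+1, (j < h)%N -> E h *m v = 0.
  rewrite memv_cap memv_ker lfunE /=; split=> [/andP[vW /eqP Pv]|[vW Pv]].
    split=> // h jh; have := EP h; rewrite jh => <-.
    by rewrite -mulmxA Pv mulmx0.
  by rewrite vW mulmx_suml big1 ?eqxx//.
have Umod : is_module (terwilliger Y x) U.
  apply: is_module_terwilliger => [h v|v] /UP[vW Ev]; apply/UP; split.
  - exact: (module_idem _ Wmod).
  - move=> l jl; rewrite mulmxA (idem_orth idemE).
    by case: eqP => _; rewrite ?mul0mx ?Ev.
  - exact: (module_dual_mx _ Wmod).
  (* Each term E_l A*_1 E_h v is 0: for h < j < l the indices l and h differ by at least 2, for h =
     j the gap applies, and for h > j the vector v is in U. *)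
  move=> l jl; rewrite [v]sum_idem_mul !mulmx_sumr big1// => h _.
  have [hj|jh|/val_inj ->] := ltngtP h j; last by rewrite Ej// !mulmx0.
    rewrite !mulmxA idem_dual_mx_idem_eq0 ?mul0mx//.
    apply: (qE one l h).1; rewrite val_one.
    by apply/orP; right; apply/orP; left; lia.
  by rewrite Ev// !mulmx0.
(* U contains the nonzero vector E_i w, and it does not contain u. *)
have [U0|UW] := Wirr U Umod (capvSl _ _).
  case/eqP: Eiw; apply/eqP; rewrite -memv0 -U0; apply/UP; split.
    exact: (module_idem _ Wmod).
  move=> h jh; rewrite mulmxA (idem_orth idemE).
  case: eqP => [hi|]; last by rewrite mul0mx.
  by move: jh; rewrite hi; lia.
have : u \in U by rewrite UW.
by case/UP => _ /(_ k jk) /eqP; rewrite (negPf Eku).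
Qed.

(** As the left side is at most 1, it is enough that E_k W is nonzero when E_i W is. Reflection
    supplies some h >= D - i >= k in the dual support, and the interval property then reaches k. *)
Lemma dual_thin_irreducible_dim_le x (W : {vspace 'cV[C]_#|X|})
    (i k : 'I_D.+1) :
  irreducible_module (terwilliger Y x) W -> dual_thin_module E W ->
  (i <= k)%N -> (k <= D - i)%N ->
  (\dim (linfun (mulmx (E i)) @: W) <= \dim (linfun (mulmx (E k)) @: W))%N.
Proof.
move=> Wirr thin ik kD; have [Wmod _ _] := Wirr.
have dimP l : (0 < \dim (linfun (mulmx (E l)) @: W)%VS)%N <->
    exists2 w, w \in W & E l *m w != 0.
  rewrite lt0n dimv_eq0; split=> [El0|[w wW Ew]].
    have /memv_imgP[w wW] := memv_pick (linfun (mulmx (E l)) @: W).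
    by rewrite lfunE /= => pE; exists w => //; rewrite -pE vpick0.
  apply: contra Ew => /eqP El0; rewrite -memv0 -El0.
  by apply/memv_imgP; exists w; rewrite // lfunE.
have [->//|] := posnP (\dim (linfun (mulmx (E i)) @: W)%VS).
move=> /dimP[w wW Eiw]; apply: leq_trans (thin i) _; apply/dimP.
have [ki|ik'|/val_inj ->] := ltngtP k i; [lia| |by exists w].
have [h Dh [u uW Ehu]] := dual_support_reflect Wmod wW Eiw.
have [hk|kh|/val_inj <-] := ltngtP h k; [lia| |by exists u].
exact: (dual_support_interval Wirr ik' kh wW Eiw uW Ehu).
Qed.

End QPolynomial.
End Krein.
End Idempotents.

(** * Comparison of multiplicities *)

Lemma dual_thin_rank_le (C : numClosedFieldType) (X : finType) (D : nat)
    (Y : assoc_scheme X D) (E : 'I_D.+1 -> 'M[C]_#|X|) (i k : 'I_D.+1) :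
  Q_polynomial Y E -> dual_thin Y E -> (i <= k)%N -> (k <= D - i)%N ->
  (\rank (E i) <= \rank (E k))%N.
Proof.
move=> [idemE [q kreinE qE]] thin ik kD.
(* Any base point serves; the multiplicities do not depend on it. *)
have /card_gt0P[x _] := scheme_points Y.
have TE j : terwilliger Y x (E j) by apply/terwilliger_bose_mesner/idem_mem.
rewrite -!dim_limg_mulmx.
apply: (module_dim_le (terwilliger_adj (x := x)) (TE i) (TE k)).
  move=> W irr.
  exact: (dual_thin_irreducible_dim_le idemE kreinE qE irr (thin x W irr)).
by move=> B w _ _; exact: memvf.
Qed.

Theorem theorem1p3 (R : realType) (X : finType) (D : nat)
    (Y : assoc_scheme X D) (E : 'I_D.+1 -> 'M[R[i]]_#|X|)
    (hQ : Q_polynomial Y E) (hthin : dual_thin Y E)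
    (i : nat) (hi : (i.*2 < D)%N) :
  (\rank (E (inord i)) <= \rank (E (inord i.+1)))%N /\
  (\rank (E (inord i)) <= \rank (E (inord (D - i))))%N.
Proof.
(* From 2i < D, both i + 1 and D - i lie between i and D - i, and all three indices are at most D,
   so [inord] returns them unchanged. *)
by split; apply: (dual_thin_rank_le hQ hthin); rewrite !inordK; lia.
Qed.
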